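(* Let $g(x_1,\ldots,x_n)$ be a term in which no variable occurs more than once, let $T$ be the tree obtained from the atomic formula $g(x_1,\ldots,x_n)\leq 0$, let $\mathcal{S}$ be the interval constraint satisfaction problem (ICSP) obtained from $T$, and let $x$ be a variable in $\mathcal{S}$. Suppose the generic propagation algorithm GPA is applied to $\mathcal{S}$ and that, after the termination of GPA (with empty active set), the domain of $x$ is changed to an interval that is a proper subset of it. If GPA is then applied to $\mathcal{S}$ (with the resulting domains) with an active set initialized with only the constraints involving $x$, then GPA terminates with the same result as when the active set would have been initialized to contain all constraints of $\mathcal{S}$.
   Context: **Intervals.** Let $F$ be a fixed finite set of reals. A floating-point number is an element of $F\cup\{-\infty,+\infty\}$. An interval is a closed connected set of reals whose bounds, in so far as they exist, are floating-point numbers; $[-\infty,+\infty]$ denotes the whole real line. **Constraints, DROs, ICSPs.** A constraint is an atomic formula $c(x_1,\ldots,x_n)$ without function symbols; its predicate symbol denotes a relation $r$ on the reals. Each variable $x_i$ has a domain $X_i$. A value $a_i$ for $x_i$ is inconsistent with respect to $r$ and the domains $X_j$ ($j\neq i$) iff there are no $a_j\in X_j$ ($j\ne i$) with $\langle a_1,\ldots,a_n\rangle\in r$. A domain reduction operator (DRO) for $c$ may replace domains of the variables of $c$ by subsets, removing only inconsistent values; every DRO is contracting, monotonic and idempotent. It is optimal if every domain is replaced by the smallest domain containing all its consistent values. A constraint is primitive if an (efficiently computable) optimal DRO is available for it; this is the DRO associated with the constraint. An ICSP is a finite set of primitive constraints together with an interval as domain for each variable. **Tree form and translation.** An atomic formula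 is viewed as a tree: the predicate symbol is the root, and its argument terms are the subtrees; a term is a variable (a leaf) or a function symbol with its argument terms as subtrees. Every node that is a function symbol is labeled with a unique new variable. Constants are replaced by unique variables whose domains contain the constants and are as small as possible. The ICSP obtained from the tree has exactly one constraint for each internal node. The root, with predicate symbol $p$ and children labeled by (or being) variables $x_0,\ldots,x_{n-1}$, yields $p(x_0,\ldots,x_{n-1})$. A non-root internal node $f(t_0,\ldots,t_{n-1})$ labeled by $y$, with children labeled by (or being) $x_0,\ldots,x_{n-1}$, yields $F(x_0,\ldots,x_{n-1},y)$, where $F(a_0,\ldots,a_{n-1},v)$ holds iff $v=f(a_0,\ldots,a_{n-1})$. **GPA.** The generic propagation algorithm maintains a set $A$ of constraints, the active set, initialized to contain all constraints. While $A\neq\emptyset$: choose a constraint $C$ from $A$ (in unspecified order); apply the DRO associated with $C$; if one of the domains has become empty, stop; add to $A$ all constraints involving variables whose domains have changed, if any; remove $C$ from $A$. The result is failure if the algorithm stops because a domain has become empty; otherwise it is the collection of domains of the variables when $A=\emptyset$. *)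

(* Defs.v *)
From HB Require Import structures.
From mathcomp Require Import all_boot all_order all_algebra.
From mathcomp Require Import all_classical all_reals all_analysis.

Set Implicit Arguments.
Unset Strict Implicit.
Unset Printing Implicit Defensive.

Import Order.TTheory GRing.Theory Num.Theory.
Import numFieldNormedType.Exports.

Local Open Scope classical_set_scope.
Local Open Scope ring_scope.

Section Intervals.
Context (R : realType).

(** [has_sup X] and [has_inf X] include non-emptiness, so [set0] and the whole
    line are intervals for every [F]. *)
Definition is_fp_interval (F X : set R) : Prop :=
  [/\ closed X, connected X, has_sup X -> F (sup X) & has_inf X -> F (inf X)].

Record domain (F : set R) := Domain {
  domain_set :> set R;
  domainP : is_fp_interval F domain_set }.

Definition smallest_domain (F : set R) (E : set R) (X : domain F) : Prop :=
  E `<=` X /\ forall Y : domain F, E `<=` Y -> X `<=` Y.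

End Intervals.

(** A predicate symbol is represented by its arity and the relation that it
    denotes. *)
Record atom (R : Type) (T : Type) := Atom {
  atom_arity : nat;
  atom_rel : set ('I_atom_arity -> R);
  atom_args : 'I_atom_arity -> T }.

Arguments atom_arity {R T} a.
Arguments atom_rel {R T} a.
Arguments atom_args {R T} a i.

(** Without function symbols, the arguments of an atomic formula are
    variables. *)
Notation constraint R V := (atom R V).

Section Constraints.
Context (R : realType) (F : set R) (V : Type).
Implicit Types (c : constraint R V) (D : V -> domain F) (x y : V).

Definition involves c x : Prop := exists i, atom_args c i = x.

Definition inconsistent c D x (a : R) : Prop :=
  ~ exists rho : V -> R,
      [/\ rho x = a,
          forall y, involves c y -> y <> x -> domain_set (D y) (rho y)
        & atom_rel c (fun i => rho (atom_args c i))].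

Definition is_dro c (d : (V -> domain F) -> V -> domain F) : Prop :=
  [/\ forall D x, ~ involves c x -> d D x = D x,
      forall D x, d D x `<=` D x,
      forall D x a, domain_set (D x) a -> ~ domain_set (d D x) a -> inconsistent c D x a,
      forall D D', (forall x, D x `<=` D' x) -> forall x, d D x `<=` d D' x
    & forall D, d (d D) = d D].

Definition is_optimal_dro c (d : (V -> domain F) -> V -> domain F) : Prop :=
  is_dro c d /\
  forall D x, involves c x ->
    smallest_domain [set a | domain_set (D x) a /\ ~ inconsistent c D x a] (d D x).

(** Primitivity of the constraints is witnessed by [icsp_dro], which gives the
    optimal operator associated with each of them. *)
Record icsp := Icsp {
  icsp_constraints : set (constraint R V);
  icsp_finite : finite_set icsp_constraints;
  icsp_dro : constraint R V -> (V -> domain F) -> V -> domain F;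
  icsp_dro_optimal :
    forall c, icsp_constraints c -> is_optimal_dro c (icsp_dro c);
  icsp_dom : V -> domain F }.

(** The type [V] may contain more than the variables of the problem. *)
Definition icsp_var (S : icsp) x : Prop :=
  exists2 c, icsp_constraints S c & involves c x.

Definition constraints_on (S : icsp) x : set (constraint R V) :=
  [set c | icsp_constraints S c /\ involves c x].

End Constraints.

Section GPA.
Context (R : realType) (F : set R) (V : Type) (S : icsp F V).
Implicit Types (A : set (constraint R V)) (D : V -> domain F).

Inductive gpa_state :=
| Running of set (constraint R V) & (V -> domain F)
| Failed.

Definition has_empty_domain D : Prop :=
  exists2 x, icsp_var S x & D x = set0 :> set R.

Definition affected D D' : set (constraint R V) :=
  [set c | icsp_constraints S c /\
           exists2 x, involves c x & D' x <> D x :> set R].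

(** One execution of the loop body; the choice of [c] in the active set is
    arbitrary. *)
Inductive gpa_step : gpa_state -> gpa_state -> Prop :=
| gpa_step_fail A D c :
    A c -> has_empty_domain (icsp_dro S c D) ->
    gpa_step (Running A D) Failed
| gpa_step_next A D c :
    A c -> ~ has_empty_domain (icsp_dro S c D) ->
    gpa_step (Running A D)
      (Running ((A `|` affected D (icsp_dro S c D)) `\ c) (icsp_dro S c D)).

Inductive gpa_reaches : gpa_state -> gpa_state -> Prop :=
| gpa_reaches_refl s : gpa_reaches s s
| gpa_reaches_step s1 s2 s3 :
    gpa_step s1 s2 -> gpa_reaches s2 s3 -> gpa_reaches s1 s3.

(** Some run from active set [A] and domains [D] ends with result [r], where
    [None] stands for failure. *)
Definition gpa_result A D (r : option (V -> domain F)) : Prop :=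
  gpa_reaches (Running A D)
    (if r is Some D' then Running set0 D' else Failed).

Definition gpa_terminates A D : Prop :=
  ~ exists s : nat -> gpa_state,
      s 0%N = Running A D /\ forall k, gpa_step (s k) (s k.+1).

(** Whatever choices are made, the algorithm terminates and its result is
    [r]. *)
Definition gpa_yields A D (r : option (V -> domain F)) : Prop :=
  gpa_terminates A D /\ forall r', gpa_result A D r' <-> r' = r.

End GPA.

(** Function symbols may denote partial functions, such as division; constants
    are not function symbols but leaves of terms. *)
Record signature (R : Type) := Signature {
  fsym : Type;
  arity : fsym -> nat;
  arity_gt0 : forall f, (0 < arity f)%N;
  fun_of_fsym : forall f, ('I_(arity f) -> R) -> option R }.

Section Terms.
Context (R : realType) (Sg : signature R) (V : Type).

Inductive term :=
| Var of V
| Cst of R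
| App (f : fsym Sg) of ('I_(arity f) -> term).

Fixpoint term_vars (t : term) : seq V :=
  match t with
  | Var x => [:: x]
  | Cst _ => [::]
  | App f ts => flatten [seq term_vars (ts i) | i <- enum 'I_(arity f)]
  end.

(** A node of a tree is identified by its path from the root, the root being
    [[::]] and the [i]-th child of [p] being [rcons p i]; [Fresh p] is the new
    variable attached to the function symbol or to the constant at [p]. *)
Inductive node_var :=
| Orig of V
| Fresh of seq nat.

Definition node_label (p : seq nat) (t : term) : node_var :=
  if t is Var x then Orig x else Fresh p.

(** The constraint F(x_0, ..., x_{n-1}, y), meaning y = f(x_0, ..., x_{n-1}),
    with [y] in the last position. *)
Definition fun_constraint (f : fsym Sg) (xs : 'I_(arity f) -> node_var)
    (y : node_var) : constraint R node_var :=
  @Atom R node_var (arity f).+1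
    [set v | fun_of_fsym (fun i => v (lift ord_max i)) = Some (v ord_max)]
    (fun j => if unlift ord_max j is Some i then xs i else y).

Fixpoint term_constraints (p : seq nat) (t : term)
    : set (constraint R node_var) :=
  match t with
  | Var _ | Cst _ => set0
  | App f ts =>
      [set @fun_constraint f (fun i => node_label (rcons p i) (ts i)) (Fresh p)]
      `|` \bigcup_(i in [set: 'I__]) term_constraints (rcons p i) (ts i)
  end.

Fixpoint term_constants (p : seq nat) (t : term) : set (seq nat * R) :=
  match t with
  | Var _ => set0
  | Cst a => [set (p, a)]
  | App f ts => \bigcup_(i in [set: 'I__]) term_constants (rcons p i) (ts i)
  end.

Definition root_constraint (P : atom R term) : constraint R node_var :=
  Atom (atom_rel P) (fun i => node_label [:: val i] (atom_args P i)).

Definition tree_constraints (P : atom R term) : set (constraint R node_var) :=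
  [set root_constraint P]
  `|` \bigcup_(i in [set: 'I__]) term_constraints [:: val i] (atom_args P i).

Definition tree_constants (P : atom R term) : set (seq nat * R) :=
  \bigcup_(i in [set: 'I__]) term_constants [:: val i] (atom_args P i).

(** The initial domains of the variables that do not replace constants are
    arbitrary intervals. *)
Definition icsp_of_tree (F : set R) (P : atom R term) (S : icsp F node_var)
    : Prop :=
  icsp_constraints S = tree_constraints P /\
  forall p a, tree_constants P (p, a) ->
    smallest_domain [set a] (icsp_dom S (Fresh p)).

Definition le0_atom (g : term) : atom R term :=
  @Atom R term 2 [set v | v ord0 <= v ord_max]
    (fun i => if i == ord0 then g else Cst 0).

End Terms.

(* Main.v *)
Require Import Defs.
From HB Require Import structures.
From mathcomp Require Import all_boot all_order all_algebra.
From mathcomp Require Import all_classical all_reals all_analysis.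

(** The statement is an instance of the confluence of chaotic iteration.

    The domains [D] left by the first run are a common fixed point of all the
    operators: a constraint leaves the active set only when its idempotent
    operator has just been applied, and comes back as soon as one of its
    variables changes ([inactive_fixed_step]).  An optimal operator looks at the
    domains of its own variables only ([optimal_dro_local]), so replacing the
    domain of [x] does not disturb the operators of the constraints that do not
    involve [x].  Hence both the set of all constraints and the set of the
    constraints on [x] are active sets outside of which every operator is
    already at rest on [D'].

    Any two such active sets, provided that they are nonempty, yield the same
    result ([gpa_yields_same]).
    - Termination: over a finite [F] there are finitely many intervals, so
      along an infinite run the domains would stop changing; from then on the
      active set would lose an element at every step.
    - Uniqueness: a run that succeeds ends with a common fixed point [E] of the
      operators, without empty domains.  By monotonicity [E] remains below the
      domains of every other run from the same start
      ([fixpoint_below_reaches]), so that no other run can fail, and the final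
      domains of two successful runs are below each other.

    Nonemptiness matters because the algorithm tests for empty domains only
    after having applied an operator; the set of the constraints on [x] is
    nonempty since [x] is a variable of the problem. *)

Set Implicit Arguments.
Unset Strict Implicit.
Unset Printing Implicit Defensive.

Local Open Scope classical_set_scope.

(** * Finiteness *)

(** Each point that is ever lost is lost at some index; take the maximum of
    these indices over the finite set. *)
Lemma finite_decreasing_stationary (T : Type) (I : set T) (B : nat -> set T) :
  finite_set I -> (forall k, B k `<=` I) -> (forall k, B k.+1 `<=` B k) ->
  exists K, forall k, (K <= k)%N -> B k = B K.
Proof.
move=> finI BI decrB.
have {}decrB j k : (j <= k)%N -> B k `<=` B j.
  move=> /subnK <-; elim: (k - j)%N => [//|m IHm].
  by rewrite addSn; apply: subset_trans IHm.
have lossP t : exists l, (exists k, ~ B k t) -> ~ B l t.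
  have [[k nBk]|noloss] := pselect (exists k, ~ B k t); first by exists k.
  by exists 0%N => /noloss.
have [loss {}lossP] := choice lossP.
have /finite_seqP[s lossI] := finite_image loss finI.
exists (\max_(l <- s) l)%N => k Kk; apply/seteqP; split; first exact: decrB.
move=> t BKt; apply: contrapT => nBkt.
have lossK : (loss t <= \max_(l <- s) l)%N.
  apply: (@leq_bigmax_seq nat s xpredT id (loss t)) => //.
  suff : [set` s] (loss t) by [].
  by rewrite -lossI; exists t => //; apply: BI BKt.
by apply: (lossP t); [exists k | apply: decrB lossK _ BKt].
Qed.

(** A connected subset of the line is determined by its bounds and by whether
    it contains them. *)
Lemma finite_fp_interval (R : realType) (F : set R) :
  finite_set F -> finite_set [set X | is_fp_interval F X].
Proof.
move=> finF.
pose bounds := [set -oo%O; +oo%O]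
  `|` (fun bx : bool * R => BSide bx.1 bx.2) @` ([set: bool] `*` F).
have finbounds : finite_set bounds.
  rewrite !finite_setU; split; first by split; apply: finite_set1.
  by apply: finite_image; apply: finite_setX.
apply: (@sub_finite_set _ _
  (set0 |` (fun b => [set` Interval b.1 b.2]) @` (bounds `*` bounds))).
  move=> X [_ connX supX infX].
  have [->|X0] := eqVneq X set0; first by left.
  right; move/connected_intervalP/is_intervalP: connX => XE.
  move/set0P: X0 => X0.
  (* [XE] rewrites [X] into its hull, whose bounds mention [X] again. *)
  exists (let: Interval l u := Rhull X in (l, u)); last by rewrite [RHS]XE.
  split=> /=; case: ifPn => [/asboolP bX|_].
  - right; exists (`[< X (inf X) >], inf X) => //; split=> //=; exact: infX.
  - by left; left.
  - right; exists (~~ `[< X (sup X) >], sup X) => //; split=> //=; exact: supX.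
  - by left; right.
by rewrite finite_setU; split; [exact: finite_set1 |
  apply: finite_image; apply: finite_setX].
Qed.

(** * Optimal operators *)

Lemma domain_inj (R : realType) (F : set R) (X Y : domain F) :
  X `<=` Y -> Y `<=` X -> X = Y.
Proof.
move: X Y => [X Xfp] [Y Yfp] /= XY YX.
have E : X = Y by apply/seteqP.
by move: Yfp; rewrite -E => Yfp; congr Domain; apply: Prop_irrelevance.
Qed.

Section Operators.
Context (R : realType) (F : set R) (V : Type).
Implicit Types (c : constraint R V) (D E : V -> domain F).
Implicit Types (d : (V -> domain F) -> V -> domain F).

Lemma sub_consistent c D1 D2 y a :
  (forall z, involves c z -> D1 z = D2 z) ->
  ~ inconsistent c D1 y a -> ~ inconsistent c D2 y a.
Proof.
move=> D12 cons1 incons2; apply: cons1 => -[rho [rhoy rhoD rhoc]].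
apply: incons2; exists rho; split=> // z cz zy.
by rewrite -D12 //; apply: rhoD.
Qed.

(** Both sides are the smallest domain containing the consistent values, and
    consistency is defined from the domains of the variables of [c]. *)
Lemma optimal_dro_local c d D1 D2 :
  is_optimal_dro c d -> (forall y, involves c y -> D1 y = D2 y) ->
  forall y, involves c y -> d D1 y = d D2 y.
Proof.
move=> [_ opt] D12 y cy.
have D21 z : involves c z -> D2 z = D1 z by move=> /D12.
have [sub1 min1] := opt D1 y cy; have [sub2 min2] := opt D2 y cy.
apply: domain_inj.
  apply: min1 => a [Da cons_a]; apply: sub2; split; first by rewrite -D12.
  exact: sub_consistent cons_a.
apply: min2 => a [Da cons_a]; apply: sub1; split; first by rewrite D12.
exact: sub_consistent cons_a.
Qed.

Lemma optimal_dro_fixed c d D1 D2 :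
  is_optimal_dro c d -> (forall y, involves c y -> D1 y = D2 y) ->
  d D1 = D1 -> d D2 = D2.
Proof.
move=> optd D12 fix1; apply/funext => y.
have [cy|ncy] := pselect (involves c y).
  by rewrite -(optimal_dro_local optd D12 cy) fix1 D12.
by have [[out _ _ _ _] _] := optd; apply: out.
Qed.

End Operators.

(** * Runs of the propagation algorithm *)

Section Runs.
Context (R : realType) (F : set R) (V : Type) (S : icsp F V).
Implicit Types (A : set (constraint R V)) (D E : V -> domain F).
Implicit Types (s : gpa_state F V).

Definition inactive_fixed A D : Prop :=
  forall c, icsp_constraints S c -> ~ A c -> icsp_dro S c D = D.

Definition active_invariant s : Prop :=
  if s is Running A D then A `<=` icsp_constraints S /\ inactive_fixed A D
  else True.

Lemma gpa_reaches_invariant (P : gpa_state F V -> Prop) s s' :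
  (forall s1 s2, gpa_step S s1 s2 -> P s1 -> P s2) ->
  gpa_reaches S s s' -> P s -> P s'.
Proof. by move=> stepP; elim=> // s1 s2 s3 /stepP P12 _ IH /P12. Qed.

Lemma gpa_reaches_rcons s1 s2 s3 :
  gpa_reaches S s1 s2 -> gpa_step S s2 s3 -> gpa_reaches S s1 s3.
Proof.
elim=> [s|s s' s'' step _ IH] last; last exact: gpa_reaches_step step (IH last).
exact: gpa_reaches_step last (gpa_reaches_refl _ _).
Qed.

(** The constraint just processed is at rest by idempotence.  A constraint that
    is not activated has kept the domains of all its variables, so that it stays
    at rest by locality. *)
Lemma inactive_fixed_step s s' :
  gpa_step S s s' -> active_invariant s -> active_invariant s'.
Proof.
case=> // A D c Ac _ [AS fixA]; split; first by move=> e [[/AS//|[]]].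
have optS e := @icsp_dro_optimal _ _ _ S e.
move=> e Se; have [-> _|ec] := pselect (e = c).
  by have [[_ _ _ _ idem] _] := optS c (AS c Ac); apply: idem.
move=> inactive_e.
apply: (@optimal_dro_fixed _ _ _ e _ D); first exact: optS.
  move=> y ey; apply: contrapT => changed; apply: inactive_e.
  split=> //; right; split=> //; exists y => // sameset.
  by apply: changed; apply: domain_inj; rewrite sameset.
by apply: fixA => // Ae; apply: inactive_e; split=> //; left.
Qed.

(** When the run has failed, the conclusion is what remains of [E] being below
    domains one of which is empty. *)
Definition above E s : Prop :=
  if s is Running A D then A `<=` icsp_constraints S /\ forall y, E y `<=` D y
  else has_empty_domain S E.

(** If [E] is below [D], then by monotonicity [E = d E] is below [d D] for the
    operator [d] of each constraint. *)
Lemma fixpoint_below_reaches E s s' :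
  (forall c, icsp_constraints S c -> icsp_dro S c E = E) ->
  gpa_reaches S s s' -> above E s -> above E s'.
Proof.
move=> fixE; apply: gpa_reaches_invariant => {s s'} s s'.
have mono A D c : A c -> above E (Running A D) ->
    forall y, E y `<=` icsp_dro S c D y.
  move=> Ac [/(_ c Ac) Sc ED] y.
  have [[_ _ _ /(_ E D ED y)]] := @icsp_dro_optimal _ _ _ S c Sc.
  by rewrite fixE.
case=> A D c Ac.
  move=> [y Sy Dy0] /(mono _ _ _ Ac)/(_ y) EDy; exists y => //.
  by rewrite -subset0 -Dy0.
move=> _ aboveE; split; last exact: mono Ac aboveE.
by have [AS _] := aboveE; move=> e [[/AS//|[]]].
Qed.

Definition below E s : Prop :=
  if s is Running A D then A `<=` icsp_constraints S /\ forall y, D y `<=` E y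
  else True.

Lemma step_contracting A D A' D' :
  A `<=` icsp_constraints S -> gpa_step S (Running A D) (Running A' D') ->
  forall y, D' y `<=` D y.
Proof.
move=> AS step; inversion step; subst=> y.
by have [[_ contr _ _ _] _] := @icsp_dro_optimal _ _ _ S c (AS c H2).
Qed.

Lemma below_reaches E s s' :
  gpa_reaches S s s' -> below E s -> below E s'.
Proof.
apply: gpa_reaches_invariant => {s s'} s s' step; case: step (step) => // A D c.
move=> Ac _ step [AS DE]; split; first by move=> e [[/AS//|[]]].
by move=> y; apply: subset_trans (step_contracting AS step (y := y)) (DE y).
Qed.

(** Emptiness is tested after each step but not on the initial domains; a
    nonempty active set forces at least one step. *)
Lemma success_no_empty_domain A D E :
  A !=set0 -> gpa_result S A D (Some E) -> ~ has_empty_domain S E.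
Proof.
move=> [c Ac] run.
pose tested s := if s is Running A D
  then A = set0 -> ~ has_empty_domain S D else True.
suff /(_ erefl) : tested (Running set0 E) by [].
apply: (@gpa_reaches_invariant tested _ _ _ run) => [s s'|/= A0].
  by case=> // A' D' c' _ tested_dom _ _.
by rewrite A0 in Ac.
Qed.

Lemma success_fixpoint A D E :
  A `<=` icsp_constraints S -> inactive_fixed A D ->
  gpa_result S A D (Some E) ->
  forall c, icsp_constraints S c -> icsp_dro S c E = E.
Proof.
move=> AS fixA run c Sc.
have [_] : active_invariant (Running set0 E).
  exact: (gpa_reaches_invariant inactive_fixed_step run).
exact.
Qed.

(** The final domains [E] of a successful run are a fixed point below the common
    starting domains, hence below all that the other run computes; the other
    run cannot empty a domain that contains one of [E]. *)
Lemma gpa_result_unique A1 A2 D r1 r2 :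
  A1 `<=` icsp_constraints S -> A1 !=set0 -> inactive_fixed A1 D ->
  A2 `<=` icsp_constraints S -> A2 !=set0 -> inactive_fixed A2 D ->
  gpa_result S A1 D r1 -> gpa_result S A2 D r2 -> r1 = r2.
Proof.
have compare A B E r : A `<=` icsp_constraints S -> A !=set0 ->
    inactive_fixed A D -> B `<=` icsp_constraints S ->
    gpa_result S A D (Some E) -> gpa_result S B D r ->
    if r is Some E' then forall y, E y `<=` E' y else False.
  move=> AS A0 fixA BS runA runB.
  have [_ ED] : below D (Running set0 E).
    by apply: (below_reaches runA); split=> // y; apply: subset_refl.
  have fixE := success_fixpoint AS fixA runA.
  have := fixpoint_below_reaches fixE runB (conj BS ED).
  case: r {runB} => [E' []//|/=].
  exact: success_no_empty_domain A0 runA.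
move=> A1S A10 fix1 A2S A20 fix2.
case: r1 r2 => [E1|] [E2|] // run1 run2.
- have E12 := compare _ _ _ _ A1S A10 fix1 A2S run1 run2.
  have E21 := compare _ _ _ _ A2S A20 fix2 A1S run2 run1.
  by congr Some; apply/funext => y; apply: domain_inj.
- by have := compare _ _ _ _ A1S A10 fix1 A2S run1 run2.
- by have := compare _ _ _ _ A2S A20 fix2 A1S run2 run1.
Qed.

Lemma finite_icsp_var : finite_set [set y | icsp_var S y].
Proof.
apply: (@sub_finite_set _ _
  (\bigcup_(c in icsp_constraints S) range (atom_args c))).
  by move=> y [c Sc [i <-]]; exists c => //; exists i.
apply: bigcup_finite; first exact: icsp_finite.
by move=> c _; apply: finite_image.
Qed.

Lemma gpa_terminating A D :
  finite_set F -> A `<=` icsp_constraints S -> gpa_terminates S A D.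
Proof.
move=> finF AS [s [s0 step]].
have /choice[AD sE] k : exists AD, s k = Running AD.1 AD.2.
  by have := step k; case: (s k) => [Ak Dk _|H]; [exists (Ak, Dk)|inversion H].
pose Ak k := (AD k).1; pose Dk k := (AD k).2.
have stepk k : gpa_step S (Running (Ak k) (Dk k))
                              (Running (Ak k.+1) (Dk k.+1)).
  by rewrite -!sE.
have subS k : Ak k `<=` icsp_constraints S.
  have : below D (Running (Ak k) (Dk k)).
    rewrite -sE; elim: k => [|k IHk].
      by rewrite s0; split=> // y; apply: subset_refl.
    by apply: below_reaches IHk; apply: gpa_reaches_step (step k)
      (gpa_reaches_refl _ _).
  by case.
have contr k y : Dk k.+1 y `<=` Dk k y by apply: step_contracting (stepk k) y.
(* The intervals contained in the domains shrink along with these, and unlike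
   the points of the domains they range over a finite set. *)
pose J k := [set yX : V * set R |
  [/\ icsp_var S yX.1, is_fp_interval F yX.2 & yX.2 `<=` Dk k yX.1]].
have [K JK] : exists K, forall k, (K <= k)%N -> J k = J K.
  apply: (finite_decreasing_stationary
    (finite_setX finite_icsp_var (finite_fp_interval finF))).
    by move=> k [y X] [].
  by move=> k [y X] [/= Sy Xfp XD]; split=> //; apply: subset_trans (contr k y).
have DK k y : (K <= k)%N -> icsp_var S y -> Dk k.+1 y = Dk k y.
  move=> Kk Sy; apply: domain_inj => //.
  have : J k (y, Dk k y : set R) by split=> //; apply: domainP.
  by rewrite JK // -(JK k.+1 (leqW Kk)) => -[].
have Astep k : (K <= k)%N -> exists2 c, Ak k c & Ak k.+1 = Ak k `\ c.
  move=> Kk; have := DK k _ Kk; have := stepk k; move: (subS k).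
  move: (Ak k) (Dk k) (Ak k.+1) (Dk k.+1) => A1 D1 A2 D2 A1S step12.
  inversion step12; subst => same; exists c => //.
  apply/seteqP; split=> e [Ae ec]; split=> //; last by left.
  case: Ae => // -[Se [y ey]]; rewrite same //; by exists e.
have [L AL] : exists L, forall k, (L <= k)%N -> Ak (K + k)%N = Ak (K + L)%N.
  apply: (finite_decreasing_stationary (icsp_finite S)) => k; first exact: subS.
  by have [c _ AE] := Astep _ (leq_addr k K); rewrite /= addnS AE => e [].
have [c Ac AE] := Astep _ (leq_addr L K).
by have := AL L.+1 (leqnSn L); rewrite addnS AE => Ec;
  move: Ac; rewrite -Ec => -[_ /(_ erefl)].
Qed.

(** A run that always performs a step when one is possible must get stuck, and
    only a failed state or an empty active set leaves no step. *)
Lemma gpa_result_exists A D :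
  gpa_terminates S A D -> exists r, gpa_result S A D r.
Proof.
move=> term.
have /choice[next nextP] s : exists s',
    gpa_step S s s' \/ s' = s /\ forall s'', ~ gpa_step S s s''.
  have [[s' step]|stuck] := pselect (exists s', gpa_step S s s').
    by exists s'; left.
  by exists s; right; split=> // s'' step; apply: stuck; exists s''.
pose run k := iter k next (Running A D).
have reach k : gpa_reaches S (Running A D) (run k).
  elim: k => [|k IHk]; first exact: gpa_reaches_refl.
  by case: (nextP (run k)) => [/(gpa_reaches_rcons IHk)|[]] //= ->.
have [k stuck] : exists k, forall s', ~ gpa_step S (run k) s'.
  apply: contrapT => nostuck; apply: term; exists run; split=> // k.
  by case: (nextP (run k)) => // -[_ stuck]; case: nostuck; exists k.
move: (reach k) stuck; case: (run k) => [A' D'|] reachk stuck; last first.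
  by exists None.
exists (Some D'); rewrite /gpa_result.
suff <- : A' = set0 by [].
rewrite -subset0 => c Ac.
have [empty|nonempty] := pselect (has_empty_domain S (icsp_dro S c D')).
  exact: stuck (gpa_step_fail Ac empty).
exact: stuck (gpa_step_next Ac nonempty).
Qed.

Lemma gpa_yields_same A1 A2 D :
  finite_set F ->
  A1 `<=` icsp_constraints S -> A1 !=set0 -> inactive_fixed A1 D ->
  A2 `<=` icsp_constraints S -> A2 !=set0 -> inactive_fixed A2 D ->
  exists r, gpa_yields S A1 D r /\ gpa_yields S A2 D r.
Proof.
move=> finF A1S A10 fix1 A2S A20 fix2.
have term1 := gpa_terminating (D := D) finF A1S.
have term2 := gpa_terminating (D := D) finF A2S.
have [r run1] := gpa_result_exists term1.
have [r2 run2] := gpa_result_exists term2.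
have r2E := gpa_result_unique A2S A20 fix2 A1S A10 fix1 run2 run1.
rewrite {}r2E {r2} in run2.
exists r; split; split=> // r'; split=> [run'|-> //].
  exact: gpa_result_unique run' run1.
exact: gpa_result_unique run' run2.
Qed.

(** The outcome of the first run is a common fixed point; changing the domain of
    [x] can only disturb the operators of the constraints on [x]. *)
Lemma gpa_restart D0 D D' x :
  finite_set F -> icsp_var S x ->
  gpa_result S (icsp_constraints S) D0 (Some D) ->
  (forall y, y <> x -> D' y = D y) ->
  exists r, gpa_yields S (constraints_on S x) D' r /\
            gpa_yields S (icsp_constraints S) D' r.
Proof.
move=> finF [c Sc cx] run D'_other.
apply: gpa_yields_same => //; [by move=> e []|by exists c| |by exists c].
move=> e Se not_on_x.
apply: (@optimal_dro_fixed _ _ _ e _ D); first exact: icsp_dro_optimal.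
  by move=> y ey; rewrite D'_other // => yx; apply: not_on_x; rewrite -yx.
by apply: (success_fixpoint _ _ run) => // ? ? [].
Qed.

End Runs.

Theorem theorem3 (R : realType) (F : set R) (finF : finite_set F)
    (Sg : signature R) (n : nat) (g : term Sg 'I_n)
    (g_linear : uniq (term_vars g))
    (S : icsp F (node_var 'I_n)) (S_of_g : icsp_of_tree (le0_atom g) S)
    (x : node_var 'I_n) (x_in_S : icsp_var S x)
    (D : node_var 'I_n -> domain F)
    (gpa_S : gpa_result S (icsp_constraints S) (icsp_dom S) (Some D))
    (D' : node_var 'I_n -> domain F)
    (D'x : domain_set (D' x) `<` domain_set (D x))
    (D'_other : forall y, y <> x -> D' y = D y) :
  exists r : option (node_var 'I_n -> domain F),
    gpa_yields S (constraints_on S x) D' r /\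
    gpa_yields S (icsp_constraints S) D' r.
Proof. exact: gpa_restart finF x_in_S gpa_S D'_other. Qed.
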